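(* Let $T=0.21$, let $w\ge T$ be the unique solution of $I_w(T)=\sqrt{T/2}$, and define $\chi:[0,1/2]\to[0,\infty)$ by $$\chi(a)=\begin{cases} I_w(a)^2, & a\in[0,T],\\ a/2, & a\in(T,1/2].\end{cases}$$ Then for every dyadic rational $\beta\in[0,1/2]$, $$W\left(\tfrac12,\beta\right)\le\beta^2+\chi\left(\tfrac12-\beta\right).$$
   Context: For $f:\{\pm1\}^n\to\{0,1\}$ and $i\in[n]=\{1,\dots,n\}$, let $\hat f_i=\mathbb{E}[f(\mathbf X)X_i]$ with $\mathbf X$ uniform on $\{\pm1\}^n$, and let $\mathbf W_1[f]=\sum_{i=1}^n\hat f_i^2$ be the level-1 Fourier weight. For dyadic rationals $a,\beta$, $$W^{(n)}(a,\beta)=\max\left\{\mathbf W_1[f]\;:\; f:\{\pm1\}^n\to\{0,1\},\ \mathbb{E}f(\mathbf X)=a,\ \max_{i\in[n]}|\hat f_i|=\beta\right\},$$ with the maximum over the empty set taken to be $-\infty$ (so the bound is vacuous there), and $W(a,\beta)=\sup_{n\ge1}W^{(n)}(a,\beta)$. Let $\phi$ and $\Phi$ be the standard Gaussian density and cumulative distribution function, and $I(t)=\phi(\Phi^{-1}(t))$ for $t\in(0,1)$, $I(0)=I(1)=0$ (the Gaussian isoperimetric profile). For $w>0$ and $0\le a\le w$, $I_w(a)=w\,I(a/w)$. *)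

(* Defs.v *)
From HB Require Import structures.
From mathcomp Require Import all_boot all_order all_algebra.
From mathcomp Require Import all_classical all_reals all_analysis.

Set Implicit Arguments.
Unset Strict Implicit.
Unset Printing Implicit Defensive.

Import Order.TTheory GRing.Theory Num.Theory.

Local Open Scope classical_set_scope.
Local Open Scope ring_scope.

(* A point of {-1, 1}^n is encoded by the bits of its coordinates, the bit b
   standing for the sign (-1) ^ b; see [cube_coord]. *)
Definition cube (n : nat) := {ffun 'I_n -> bool}.

(* A {0, 1}-valued function on the cube; a value b : bool is read in R as b%:R. *)
Definition boolfun (n : nat) := {ffun cube n -> bool}.

Section BooleanFunctions.
Context {R : realType} {n : nat}.

Definition cube_coord (i : 'I_n) (x : cube n) : R := (-1) ^+ x i.

Definition expect (F : cube n -> R) : R := (\sum_x F x) / #|{: cube n}|%:R.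

Definition mean (f : boolfun n) : R := expect (fun x => (f x)%:R).

Definition fhat (f : boolfun n) (i : 'I_n) : R :=
  expect (fun x => (f x)%:R * cube_coord i x).

Definition weight1 (f : boolfun n) : R := \sum_i fhat f i ^+ 2.

(* The base value 0 of the maximum is harmless for n >= 1 since all the terms
   are nonnegative. *)
Definition max_fhat (f : boolfun n) : R := \big[Num.max/0]_i `|fhat f i|.

End BooleanFunctions.

Section MaximalWeight.
Context {R : realType}.

Definition dyadic (x : R) : Prop :=
  exists (m : int) (k : nat), x = m%:~R / 2 ^+ k.

Definition Wn (n : nat) (a beta : R) : \bar R :=
  \big[maxe/-oo%E]_(f : boolfun n | (mean f == a) && (max_fhat f == beta))
    (weight1 f)%:E.

Definition W (a beta : R) : \bar R :=
  ereal_sup [set Wn n a beta | n in [set n : nat | (1 <= n)%N]].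

End MaximalWeight.

Section GaussianProfile.
Context {R : realType}.

Definition phi (x : R) : R := normal_pdf 0 1 x.

Definition Phi (x : R) : R := fine (normal_prob 0 1 `]-oo, x]).

(* [Phi] is a bijection from R onto ]0, 1[; its inverse is only meaningful
   there. *)
Definition Phi_inv : R -> R := 'pinv_(fun=> 0) setT Phi.

Definition iso_profile (t : R) : R := if (0 < t) && (t < 1) then phi (Phi_inv t) else 0.

(* Used for 0 < w and 0 <= a <= w. *)
Definition Iw (w a : R) : R := w * iso_profile (a / w).

(* Used for 0 <= a <= 1 / 2. *)
Definition chi (T w a : R) : R := if a <= T then Iw w a ^+ 2 else a / 2.

End GaussianProfile.

(* Main.v *)
(* Splitting a balanced [f] along a coordinate with [|fhat f i| = beta] and
   complementing one half leaves two functions of mean [1 / 2 - beta], so it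
   suffices to bound [weight1 g] by [chi (mean g)] for every [g].
   Bessel's inequality for the odd part of [g] gives [weight1 g <= mean g / 2].
   When [mean g <= T], induct on the dimension: with [J = Iw w], gluing the two
   halves of [g] requires
     [((a - b) / 2)^2 + ((J a + J b) / 2)^2 <= J ((a + b) / 2)^2].
   Writing [F h] for the left-hand side at [m - h, m + h], the equation
   [J'' = - 1 / J] turns [F'' <= 0] into
     [phi x * phi y * (y - x)^2 <= (phi y - phi x)^2],
   where [x, y] are the Gaussian quantiles; this is [sinh u >= u] as soon as
   [x + y <= - 2], which holds when [m / w <= Phi (- 1)]. The value of [T] is
   such that [T / w] is just below [Phi (- 1)]. A half may have mean [b] in
   [[T, 2 T]]; there the Bessel bound is used, as [b / 2 <= J b ^ 2]. *)
Require Import Defs.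
From HB Require Import structures.
From mathcomp Require Import all_boot all_order all_algebra.
From mathcomp Require Import all_classical all_reals all_analysis.
From mathcomp Require Import ring lra.

Set Implicit Arguments.
Unset Strict Implicit.
Unset Printing Implicit Defensive.

Import Order.TTheory GRing.Theory Num.Theory.
Import numFieldNormedType.Exports.
Local Open Scope classical_set_scope.
Local Open Scope ring_scope.

(** * Monotonicity from the sign of a derivative *)

Section Monotonicity.
Context {R : realType}.
Implicit Types (f df : R -> R) (a b x d : R).

Lemma is_derive_fun_add (f g : R -> R) x a b :
  is_derive x 1 f a -> is_derive x 1 g b ->
  is_derive x 1 (fun y => f y + g y) (a + b).
Proof. exact: is_deriveD. Qed.

Lemma is_derive_fun_mul (f g : R -> R) x a b :
  is_derive x 1 f a -> is_derive x 1 g b ->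
  is_derive x 1 (fun y => f y * g y) (f x * b + g x * a).
Proof. exact: is_deriveM. Qed.

Lemma derive_continuous f x d : is_derive x 1 f d -> {for x, continuous f}.
Proof. by move=> fx; apply/differentiable_continuous/derivable1_diffP. Qed.

Lemma mean_value f df a b : a < b ->
  (forall x, a <= x <= b -> is_derive x 1 f (df x)) ->
  exists2 c, a < c < b & f b - f a = df c * (b - a).
Proof.
move=> ab fd; have [||c cab ->] := @MVT _ f df _ _ ab.
- move=> x; rewrite in_itv/= => /andP[ax xb]; apply: fd.
  by rewrite !ltW.
- apply: derivable_within_continuous => x; rewrite in_itv/= => xab.
  exact: (@ex_derive _ _ _ _ _ _ _ (fd _ xab)).
- by exists c => //; move: cab; rewrite in_itv.
Qed.

Lemma derive_ge0_le f df a b : a <= b ->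
  (forall x, a <= x <= b -> is_derive x 1 f (df x)) ->
  (forall x, a < x < b -> 0 <= df x) -> f a <= f b.
Proof.
rewrite le_eqVlt => /predU1P[->//|ab] fd df0.
have [c cab E] := mean_value ab fd.
by rewrite -subr_ge0 E mulr_ge0 ?df0// subr_ge0 ltW.
Qed.

Lemma derive_gt0_lt f df a b : a < b ->
  (forall x, a <= x <= b -> is_derive x 1 f (df x)) ->
  (forall x, a < x < b -> 0 < df x) -> f a < f b.
Proof.
move=> ab fd df0; have [c cab E] := mean_value ab fd.
by rewrite -subr_gt0 E mulr_gt0 ?df0// subr_gt0.
Qed.

Lemma derive_le0_ge f df a b : a <= b ->
  (forall x, a <= x <= b -> is_derive x 1 f (df x)) ->
  (forall x, a < x < b -> df x <= 0) -> f b <= f a.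
Proof.
rewrite le_eqVlt => /predU1P[->//|ab] fd df0.
have [c cab E] := mean_value ab fd.
by rewrite -subr_le0 E mulr_le0_ge0 ?df0// subr_ge0 ltW.
Qed.

End Monotonicity.

(** * The Gaussian distribution function, its inverse and the derivative of the profile *)

Section GaussianDistribution.
Context {R : realType}.
Implicit Types x y t : R.
Local Notation phi := (@phi R).
Local Notation Phi := (@Phi R).
Local Notation Phi_inv := (@Phi_inv R).

Lemma phiE x : phi x = normal_peak 1 * expR (- x ^+ 2 / 2).
Proof.
rewrite /phi normal_pdfE ?oner_eq0// /normal_fun subr0.
by rewrite expr1n.
Qed.

Lemma phi_gt0 x : 0 < phi x.
Proof. by rewrite phiE mulr_gt0 ?expR_gt0// normal_peak_gt0 ?oner_eq0. Qed.

Lemma phiN x : phi (- x) = phi x.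
Proof. by rewrite !phiE sqrrN. Qed.

Lemma is_derive_phi x : is_derive x 1 phi (- x * phi x).
Proof.
have sqr : is_derive x 1 (fun y : R => y ^+ 2) (2 * x).
  by have := @is_deriveX _ _ id 2 x 1 1 (is_derive_id _ _); rewrite /GRing.scale/= mulr1 expr1.
have dexp : is_derive x 1 (fun y : R => - y ^+ 2 / 2) (- x).
  have := is_derive_fun_mul (is_deriveN sqr) (is_derive_cst (2^-1 : R) x 1).
  by move=> h; apply: is_derive_eq h _; rewrite /=; field.
have := is_derive_fun_mul (is_derive_cst (normal_peak 1 : R) x 1)
  (is_derive1_comp (is_derive_expR _) dexp).
rewrite (_ : phi = fun y => normal_peak 1 * expR (- y ^+ 2 / 2)).
  by move=> h; apply: is_derive_eq h _; rewrite /=; ring.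
by apply/funext => y; rewrite phiE.
Qed.

Lemma ler_phi x y : `|y| <= `|x| -> phi x <= phi y.
Proof.
move=> yx; rewrite !phiE ler_pM2l ?normal_peak_gt0 ?oner_eq0// ler_expR.
rewrite ler_pM2r ?invr_gt0// lerN2 -[x ^+ 2]real_normK ?num_real//.
by rewrite -[y ^+ 2]real_normK ?num_real// ler_sqr ?nnegrE.
Qed.

Lemma is_derive_Phi x : is_derive x 1 Phi (phi x).
Proof.
have [||||dF FE] := @continuous_FTC1 R phi -oo%O x (x + 1).
- by rewrite ltrDl.
- apply: (integrableS _ _ (@subsetT _ _)) => //.
  exact: integrable_normal_pdf.
- by rewrite ltNyr.
- by apply: continuous_normal_pdf; rewrite oner_eq0.
by apply: DeriveDef; [exact: dF|rewrite -derive1E FE].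
Qed.

Lemma Phi_lt x y : x < y -> Phi x < Phi y.
Proof.
move=> xy; apply: (derive_gt0_lt xy (fun z _ => is_derive_Phi z)) => z _.
exact: phi_gt0.
Qed.

Lemma Phi_mono : {mono Phi : x y / x < y}.
Proof. by apply: leW_mono; apply: le_mono => x y; exact: Phi_lt. Qed.

Lemma Phi_le_mono : {mono Phi : x y / x <= y}.
Proof. by apply: le_mono => x y; exact: Phi_lt. Qed.

Lemma Phi_inj : injective Phi.
Proof. exact: inc_inj Phi_le_mono. Qed.

Lemma Phi_ge0 x : 0 <= Phi x.
Proof. by rewrite fine_ge0// measure_ge0. Qed.

Lemma Phi_gt0 x : 0 < Phi x.
Proof. by apply: le_lt_trans (Phi_ge0 (x - 1)) _; rewrite Phi_mono ltrBlDr ltrDl. Qed.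

(** The identity, seen as a random variable under the Gaussian law, has [Phi] as its [cdf]; this
    gives access to the limits at both infinities. *)
Let ident : measurableTypeR R -> R := idfun.

#[local] HB.instance Definition _ :=
  @isMeasurableFun.Build _ _ _ _ ident (@measurable_id _ _ setT).

Let gauss : probability (measurableTypeR R) R := normal_prob 0 1.

Let Phi_cdf : Phi = fine \o cdf (ident : {RV gauss >-> R}).
Proof. by []. Qed.

Lemma Phi_onto t : 0 < t < 1 -> exists x, Phi x = t.
Proof.
move=> /andP[t0 t1].
have [a at_] : exists a, Phi a < t.
  suff : \forall x \near -oo, Phi x < t by move/filter_ex.
  apply: cvgr_lt t0; rewrite Phi_cdf.
  exact/fine_cvg/cvg_cdfNy0.
have [b tb] : exists b, t < Phi b.
  suff : \forall x \near +oo, t < Phi x by move/filter_ex.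
  apply: cvgr_gt t1; rewrite Phi_cdf.
  exact/fine_cvg/cvg_cdfy1.
have ab : a <= b by rewrite -Phi_le_mono (le_trans (ltW at_) (ltW tb)).
have [||x _ <-] := @IVT R Phi a b t ab; last by exists x.
- apply: continuous_subspaceT => x; exact: (derive_continuous (is_derive_Phi x)).
- by rewrite ge_min le_max (ltW at_) (ltW tb) orbT.
Qed.

Lemma Phi_lt1 x : Phi x < 1.
Proof.
apply: (@lt_le_trans _ _ (Phi (x + 1))); first by rewrite Phi_mono ltrDl.
rewrite Phi_cdf /= -[leRHS]/(fine 1%E) fine_le//; last exact: cdf_le1.
by rewrite fin_num_measure//; exact: measurable_funPTI.
Qed.

Lemma PhiK : cancel Phi Phi_inv.
Proof. by move=> x; apply: pinvKV; rewrite ?inE// => ? ? _ _; exact: Phi_inj. Qed.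

Lemma iso_profile_Phi x : iso_profile (Phi x) = phi x.
Proof. by rewrite /iso_profile Phi_gt0 Phi_lt1 PhiK. Qed.

Lemma iso_profile_ge0 t : 0 <= @iso_profile R t.
Proof. by rewrite /iso_profile; case: ifP => // _; rewrite ltW ?phi_gt0. Qed.

Lemma is_derive_Phi_inv t : 0 < t < 1 ->
  is_derive t 1 Phi_inv (phi (Phi_inv t))^-1.
Proof.
move=> /Phi_onto[x <-]; rewrite PhiK.
apply: (@is_derive_inverse _ Phi).
- by apply: filterE => y; exact: PhiK.
- by apply: filterE => y; exact: (derive_continuous (is_derive_Phi y)).
- exact: is_derive_Phi.
- by rewrite gt_eqF ?phi_gt0.
Qed.

(** In [phi \o Phi_inv] the factor [phi] of [phi'] cancels the derivative [1 / phi] of the quantile.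
    The default value of the profile does not interfere, since []0, 1[] is a neighbourhood of
    [t]. *)
Lemma is_derive_iso_profile t : 0 < t < 1 ->
  is_derive t 1 (@iso_profile R) (- Phi_inv t).
Proof.
move=> t01; have := is_derive1_comp (is_derive_phi _) (is_derive_Phi_inv t01).
rewrite -mulrA divff ?gt_eqF ?phi_gt0// mulr1.
apply: near_eq_is_derive.
have : \forall s \near t, s \in `]0, 1[%R by apply: near_in_itvoo; rewrite in_itv.
by apply: filterS => s; rewrite in_itv /iso_profile/= => ->.
Qed.

End GaussianDistribution.

(** * The two-point inequality for the profile at interior points *)

Section TwoPoint.
Context {R : realType}.
Implicit Types x y z s t m h u d : R.
Local Notation phi := (@phi R).
Local Notation Phi := (@Phi R).
Local Notation Phi_inv := (@Phi_inv R).
Local Notation I := (@iso_profile R).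

Lemma is_derive_reflect (f : R -> R) c x d :
  is_derive (c - x) 1 f d -> is_derive x 1 (fun y => f (c - y)) (- d).
Proof.
move=> fd; rewrite -[- d]mulrN1; apply: is_derive1_comp.
have := is_derive_fun_add (is_derive_cst c x 1) (is_deriveNid x 1).
by rewrite add0r.
Qed.

Lemma is_derive_translate (f : R -> R) c x d :
  is_derive (c + x) 1 f d -> is_derive x 1 (fun y => f (c + y)) d.
Proof.
move=> fd; rewrite -[d]mulr1; apply: is_derive1_comp.
have := is_derive_fun_add (is_derive_cst c x 1) (is_derive_id x 1).
by rewrite add0r.
Qed.

(** As [phi] is even, [Phi x + Phi (- x)] is constant. If it exceeded 1, taking
    [Phi x = 2 * Phi 0 - 1] would force [Phi (- x) = 1]. *)
Lemma Phi0_le_half : Phi 0 <= 1 / 2.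
Proof.
have sym x : Phi x + Phi (- x) = Phi 0 + Phi 0.
  have -> : Phi 0 + Phi 0 = Phi 0 + Phi (- 0) by rewrite oppr0.
  apply: (@is_derive_0_is_cst _ (fun x => Phi x + Phi (- x))) => y.
  have := is_derive_fun_add (is_derive_Phi y)
    (is_derive1_comp (is_derive_Phi (- y)) (is_deriveNid y 1)).
  by rewrite phiN mulrN1 subrr.
rewrite leNgt; apply/negP => Phi0_gt.
have [|x xE] := @Phi_onto R (Phi 0 + Phi 0 - 1).
  by have := Phi_lt1 (0 : R); lra.
by have := sym x; have := Phi_lt1 (- x); lra.
Qed.

(** For [y >= 0], the point [- 1 + y] is at least as close to 0 as [- 1 - y], so [phi] is at least
    as large there and the right-hand side grows with [d >= 0]. *)
Lemma Phi_spread d : Phi (- 1) + Phi (- 1) <= Phi (- 1 + d) + Phi (- 1 - d).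
Proof.
wlog d0 : d / 0 <= d => [|].
  move=> H; case: (leP 0 d) => [|d0]; first exact: H.
  have Nd0 : 0 <= - d by rewrite oppr_ge0 ltW.
  by have := H _ Nd0; rewrite opprK => /le_trans; apply; rewrite addrC.
pose f y := Phi (- 1 + y) + Phi (- 1 - y).
suff : f 0 <= f d by rewrite /f subr0 addr0.
apply: (@derive_ge0_le _ f (fun y => phi (- 1 + y) + - phi (- 1 - y))) => //.
- move=> y _; apply: is_derive_fun_add.
  + exact/is_derive_translate/is_derive_Phi.
  + exact/is_derive_reflect/is_derive_Phi.
- move=> y /andP[y0 _]; rewrite subr_ge0; apply: ler_phi.
  by rewrite [leRHS]ler0_norm ?ler_norml; lra.
Qed.

(** Were [x + y > - 2], then [y] would lie beyond the reflection of [x] in [- 1], and [Phi_spread]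
    would make the mean of [Phi x] and [Phi y] exceed [Phi (- 1)]. *)
Lemma Phi_mean_sum_le x y z :
  z <= - 1 -> Phi x + Phi y = Phi z + Phi z -> x + y <= - 2.
Proof.
move=> z1 E; rewrite leNgt; apply/negP => xy.
have := Phi_spread (x + 1); rewrite (_ : - 1 + (x + 1) = x); last by ring.
have : Phi (- 1 - (x + 1)) < Phi y by rewrite Phi_mono; lra.
by move: z1; rewrite -Phi_le_mono; clear - E; lra.
Qed.

Lemma sinh_ge u : 0 <= u -> u + u <= expR u - expR (- u).
Proof.
move=> u0; pose f (v : R) := expR v + (- expR (0 - v) + - (v + v)).
suff : f 0 <= f u by rewrite /f !sub0r oppr0; lra.
apply: (@derive_ge0_le _ f (fun v => expR v + (expR (0 - v) + - (1 + 1)))) => //.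
- move=> v _; apply: is_derive_fun_add (is_derive_expR v) _.
  rewrite -[expR (0 - v)]opprK; apply: is_derive_fun_add.
  exact: is_deriveN (is_derive_reflect (is_derive_expR _)).
- move=> v _; have := expR_ge1Dx v; have := expR_ge1Dx (0 - v); lra.
Qed.

(** With [p] the geometric mean of [phi x] and [phi y], the difference [phi y - phi x] is
    [2 p sinh u], and [x + y <= - 2] gives [y - x <= 2 u] when [x <= y]. *)
Lemma phi_gap x y : x + y <= - 2 ->
  phi x * phi y * (y - x) ^+ 2 <= (phi y - phi x) ^+ 2.
Proof.
wlog xy : x y / x <= y => [H|].
  case: (leP x y) => [|/ltW]; first exact: H.
  move=> yx; rewrite addrC => /(H _ _ yx).
  by rewrite -sqrrN opprB [X in X * _]mulrC -[leRHS]sqrrN opprB.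
move=> xy2; pose u := (x ^+ 2 - y ^+ 2) / 4.
pose p : R := normal_peak 1 * expR (- (x ^+ 2 + y ^+ 2) / 4).
have px : phi x = p * expR (- u).
  by rewrite phiE /p -mulrA -expRD; congr (_ * expR _); rewrite /u; field.
have py : phi y = p * expR u.
  by rewrite phiE /p -mulrA -expRD; congr (_ * expR _); rewrite /u; field.
have yxu : y - x <= u + u.
  have -> : u + u = (y - x) * (- (x + y) / 2) by rewrite /u; field.
  by rewrite ler_peMr ?subr_ge0//; lra.
have u0 : 0 <= u by move: yxu; set v := u; lra.
rewrite px py [X in X * _]mulrACA -expRD addNr expR0 mulr1 -mulrBr exprMn -expr2.
rewrite ler_wpM2l ?sqr_ge0// ler_sqr ?nnegrE ?subr_ge0//.
  exact: le_trans yxu (sinh_ge u0).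
by rewrite ler_expR; move: u0; set v := u; lra.
Qed.

(* Along [s], the second derivative of [4 s^2 + (I (m + s) + I (m - s))^2] is
   at most 0: as [I'' = - 1 / I], this is the inequality of [phi_gap] at the
   quantiles of [m - s] and [m + s]. *)
Lemma two_point_interior m h : 0 <= h -> h < m -> m + h < 1 -> m <= Phi (- 1) ->
  4 * h ^+ 2 + (I (m + h) + I (m - h)) ^+ 2 <= 4 * I m ^+ 2.
Proof.
move=> h0 hm mh1 m1.
have in01 s : 0 <= s <= h -> (0 < m + s < 1) && (0 < m - s < 1) by lra.
pose K s := I (m + s) + I (m - s).
pose D s := - Phi_inv (m + s) + Phi_inv (m - s).
have dK s : 0 <= s <= h -> is_derive s 1 K (D s).
  move=> /in01/andP[s1 s2]; apply: is_derive_fun_add.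
  - exact/is_derive_translate/is_derive_iso_profile.
  - rewrite -[Phi_inv _]opprK.
    exact/is_derive_reflect/is_derive_iso_profile.
pose dD s := - (phi (Phi_inv (m + s)))^-1 + - (phi (Phi_inv (m - s)))^-1.
have dDE s : 0 <= s <= h -> is_derive s 1 D (dD s).
  move=> /in01/andP[s1 s2]; apply: is_derive_fun_add.
  - exact/is_deriveN/is_derive_translate/is_derive_Phi_inv.
  - exact/is_derive_reflect/is_derive_Phi_inv.
(* Half the derivative of [F] below; it vanishes at 0 and is nonincreasing by [phi_gap]. *)
pose G s := 4 * s + K s * D s.
have G_le0 s : 0 <= s <= h -> G s <= 0.
  move=> /andP[s0 sh]; have G0 : G 0 = 0.
    by rewrite /G /D addr0 subr0 addNr !mulr0 addr0.
  rewrite -G0; apply: (@derive_le0_ge _ G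
    (fun s => (4 * 1 + s * 0) + (K s * dD s + D s * D s)) 0 s s0).
    move=> r rs; have rh : 0 <= r <= h by lra.
    exact: is_derive_fun_add
      (is_derive_fun_mul (is_derive_cst (4 : R) r 1) (is_derive_id r 1))
      (is_derive_fun_mul (dK _ rh) (dDE _ rh)).
  move=> r rs; have /in01/andP[r1 r2] : 0 <= r <= h by lra.
  have [z zE] : exists z, Phi z = m by apply: Phi_onto; lra.
  rewrite /K /dD /D; have [x xE] := Phi_onto r2; have [y yE] := Phi_onto r1.
  rewrite -xE -yE !PhiK !iso_profile_Phi.
  have /phi_gap : x + y <= - 2.
    apply: (@Phi_mean_sum_le _ _ z); last by lra.
    by rewrite -Phi_le_mono zE.
  have px := phi_gt0 x; have py := phi_gt0 y; move=> gap.
  have -> : 4 * 1 + r * 0 + ((phi y + phi x) * (- (phi y)^-1 + - (phi x)^-1) +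
      (- y + x) * (- y + x)) =
      (phi x * phi y * (y - x) ^+ 2 - (phi y - phi x) ^+ 2) / (phi x * phi y).
    by field; rewrite !gt_eqF.
  by rewrite pmulr_lle0 ?invr_gt0 ?mulr_gt0// subr_le0.
pose F s := (4 * s) * s + K s * K s.
suff : F h <= F 0.
  rewrite /F /K addr0 subr0 => FE; apply: le_trans (_ : _ <= F h) _.
    by rewrite /F /K; lra.
  by apply: le_trans FE _; lra.
apply: (@derive_le0_ge _ F
  (fun s => ((4 * s) * 1 + s * (4 * 1 + s * 0)) + (K s * D s + K s * D s)) 0 h h0).
- move=> s sh; have d4 := is_derive_fun_mul (is_derive_cst (4 : R) s 1) (is_derive_id s 1).
  exact: is_derive_fun_add (is_derive_fun_mul d4 (is_derive_id s 1))
    (is_derive_fun_mul (dK _ sh) (dK _ sh)).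
- move=> s sh; have /G_le0 : 0 <= s <= h by lra.
  by rewrite /G; lra.
Qed.

End TwoPoint.

(** * The two-point inequality up to the end point 0, and bounds on the Mills ratio *)

Section MillsRatio.
Context {R : realType}.
Implicit Types x y z s t m h u d : R.
Local Notation phi := (@phi R).
Local Notation Phi := (@Phi R).
Local Notation Phi_inv := (@Phi_inv R).
Local Notation I := (@iso_profile R).

Lemma Phi_N1_lt_half : Phi (- 1) < 1 / 2.
Proof. by apply: lt_le_trans Phi0_le_half; rewrite Phi_mono; lra. Qed.

(** What remains beyond the interior case is [a = 0], where the quantile of the smaller point is
    infinite: a strict violation there would persist at nearby interior pairs. *)
Lemma two_point a b : 0 <= a -> 0 <= b -> (a + b) / 2 <= Phi (- 1) ->
  (a - b) ^+ 2 + (I a + I b) ^+ 2 <= 4 * I ((a + b) / 2) ^+ 2.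
Proof.
wlog ab : a b / a <= b => [H|].
  case: (leP a b) => [|/ltW ba]; first exact: H.
  by move=> a0 b0; rewrite -sqrrN opprB (addrC a) (addrC (I a)); exact: H.
move=> a0 b0 m1; have half := Phi_N1_lt_half.
have interior c : 0 < c -> c <= b -> (c + b) / 2 <= Phi (- 1) ->
    (c - b) ^+ 2 + (I c + I b) ^+ 2 <= 4 * I ((c + b) / 2) ^+ 2.
  move=> c0 cb cm; have := @two_point_interior _ ((c + b) / 2) ((b - c) / 2).
  rewrite (_ : _ + (b - c) / 2 = b); last by field.
  rewrite (_ : _ - (b - c) / 2 = c); last by field.
  by move=> H; apply: le_trans (H _ _ _ cm); lra.
have [a_gt0|] := ltP 0 a; first exact: interior.
move=> a_le0; have {a_le0}aE : a = 0 by lra.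
rewrite aE sub0r sqrrN add0r in m1 *.
have I0 : I 0 = 0 by rewrite /iso_profile ltxx.
rewrite I0 add0r.
have [b_le0|b_gt0] := leP b 0.
  have -> : b = 0 by lra.
  by rewrite mul0r I0 expr0n/= !addr0 mulr0.
set m := b / 2 in m1 *; have bE : b = m + m by rewrite /m; field.
have m0 : 0 < m by lra.
rewrite leNgt; apply/negP => gap.
(* Only [I (m + s)] is kept, so that [g] is continuous at [m]; the dropped [I (m - s)] is
   nonnegative, hence [g s] is at most the interior left-hand side. *)
pose g s := (4 * s) * s + I (m + s) * I (m + s).
have gm : 4 * I m ^+ 2 < g m by apply: lt_le_trans gap _; rewrite /g -bE /m; lra.
have dI : is_derive m 1 (fun s => I (m + s)) (- Phi_inv (m + m)).
  by apply/is_derive_translate/is_derive_iso_profile; lra.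
have d4 := is_derive_fun_mul (is_derive_cst (4 : R) m 1) (is_derive_id m 1).
have gc : {for m, continuous g}.
  exact: derive_continuous (is_derive_fun_add
    (is_derive_fun_mul d4 (is_derive_id m 1)) (is_derive_fun_mul dI dI)).
have : \forall s \near m^'-, 4 * I m ^+ 2 < g s /\ 0 < s < m.
  near=> s; split.
    by near: s; apply: cvgr_gt gm; apply: cvg_at_left_filter; exact: gc.
  by apply/andP; split; near: s; [exact: nbhs_left_gt|exact: nbhs_left_lt].
move=> /(@filter_ex _ _ (at_left_proper_filter m))[s [gs /andP[s0 sm]]].
have := @two_point_interior _ m s (ltW s0) sm.
have := @iso_profile_ge0 R (m - s); have := @iso_profile_ge0 R (m + s).
move: gs; rewrite /g; set p := I _; set q := I _; set r := I _ => gs q0 r0 H.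
have {H} : 4 * s ^+ 2 + (q + r) ^+ 2 <= 4 * p ^+ 2 by apply: H; lra.
nra.
Unshelve. all: by end_near. Qed.

(* The ratio [Phi / phi] solves [M' - x M = 1]; [M] is a subsolution. *)
Lemma Phi_mills_step (M dM : R -> R) a b : a <= b ->
  (forall x, a <= x <= b -> is_derive x 1 M (dM x)) ->
  (forall x, a < x < b -> dM x - x * M x <= 1) ->
  Phi a - M a * phi a <= Phi b - M b * phi b.
Proof.
move=> ab dME dM1.
apply: (@derive_ge0_le _ (fun x => Phi x - M x * phi x)
  (fun x => phi x - (M x * (- x * phi x) + phi x * dM x))) => //.
- move=> x xab; apply: is_derive_fun_add (is_derive_Phi x) _.
  exact: is_deriveN (is_derive_fun_mul (dME _ xab) (is_derive_phi x)).
- move=> x /dM1 H; have px := phi_gt0 x.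
  have -> : phi x - (M x * (- x * phi x) + phi x * dM x) =
    phi x * (1 - (dM x - x * M x)) by ring.
  by rewrite mulr_ge0 ?subr_ge0// ltW.
Qed.

(* The subsolution is linear on [[- 4, - 2]], vanishing at [- 4], and continued
   by a cubic on [[- 2, - 1]]. *)
Lemma Phi_N1_ge : 65 / 100 * phi 1 <= Phi (- 1).
Proof.
have step1 : Phi (- 4) - (4 - 4) / 5 * phi (- 4) <=
    Phi (- 2) - (4 - 2) / 5 * phi (- 2).
  apply: (@Phi_mills_step (fun x => (4 + x) / 5) (fun=> (4 + 0) * 0 + 5^-1 * 1)).
  - lra.
  - move=> x _.
    have := is_derive_fun_mul (is_derive_translate (c := 4) (is_derive_id (4 + x) 1))
      (is_derive_cst (5^-1 : R) x 1).
    by move=> H; apply: is_derive_eq H _; rewrite /=; ring.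
  - by move=> x xb; nra.
(* With [s = 2 + x], the defect [1 - (M' - x M)] is [s^2 (1 - s)^2 / 20]; the cubic ends at
   [2/5 + 1/5 + 1/20 = 65/100]. *)
have step2 : Phi (- 2) - (2 / 5 + (2 - 2) / 5 + (2 - 2) ^+ 3 / 20) * phi (- 2) <=
    Phi (- 1) - (2 / 5 + (2 - 1) / 5 + (2 - 1) ^+ 3 / 20) * phi (- 1).
  apply: (@Phi_mills_step (fun x => 2 / 5 + (2 + x) / 5 + (2 + x) ^+ 3 / 20)
     (fun x => 1 / 5 + 3 * (2 + x) ^+ 2 / 20)).
  - lra.
  - move=> x _.
    have d1 := is_derive_fun_mul (is_derive_translate (c := 2) (is_derive_id (2 + x) 1))
      (is_derive_cst (5^-1 : R) x 1).
    have d3 := is_derive_fun_mul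
      (is_derive_translate (c := 2) (is_deriveX 3 (is_derive_id (2 + x) 1)))
      (is_derive_cst (20^-1 : R) x 1).
    have := is_derive_fun_add (is_derive_fun_add (is_derive_cst (2 / 5 : R) x 1) d1) d3.
    by move=> H; apply: is_derive_eq H _; rewrite /GRing.scale/=; field.
  - move=> x /andP[x2 x1].
    suff : 0 <= (2 + x) ^+ 2 * (1 - (2 + x)) ^+ 2 by nra.
    by rewrite mulr_ge0 ?sqr_ge0.
have := Phi_ge0 (- 4 : R); move: step1 step2; rewrite !phiN; lra.
Qed.

(** For [x < 0], with [x] frozen, [P y = phi y + x * Phi y] has derivative [(x - y) * phi y], so it
    increases up to [x] from its limit 0 at minus infinity. *)
Lemma mills_lt x : - x * Phi x < phi x.
Proof.
have [x0|x0] := leP 0 x.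
  apply: le_lt_trans (phi_gt0 x).
  by rewrite mulNr oppr_le0 mulr_ge0// Phi_ge0.
pose P y := phi y + x * Phi y.
have dP y : is_derive y 1 P (- y * phi y + (x * phi y + Phi y * 0)).
  exact: is_derive_fun_add (is_derive_phi y)
    (is_derive_fun_mul (is_derive_cst x y 1) (is_derive_Phi y)).
have P_lt y z : y < z -> z <= x -> P y < P z.
  move=> yz zx; apply: derive_gt0_lt yz (fun t _ => dP t) _ => t tyz.
  by have := phi_gt0 t; nra.
suff : 0 <= P (x - 1).
  have := @P_lt (x - 1) x; rewrite /P => H H'; have : x - 1 < x by lra.
  by move/H => /(_ (lexx _)); lra.
rewrite leNgt; apply/negP => P1.
(* This [t] replaces the limit: [x * Phi t] is at least half the supposed negative value
   [P (x - 1)]. The [1 / 2] keeps the target below 1. *)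
have [t tE] : exists t, Phi t = Num.min (1 / 2) (P (x - 1) / (2 * x)).
  apply: Phi_onto; rewrite lt_min gt_min.
  have -> : 0 < P (x - 1) / (2 * x) by rewrite ltr_ndivlMr; lra.
  lra.
have Pt : P (x - 1) / 2 <= x * Phi t.
  have H : Phi t <= P (x - 1) / (2 * x) by rewrite tE ge_min lexx orbT.
  have -> : P (x - 1) / 2 = x * (P (x - 1) / (2 * x)).
    by field; rewrite lt_eqF.
  by rewrite ler_nM2l.
have [tx|xt] := ltP t (x - 1).
  have xx : x - 1 <= x by lra.
  by have := P_lt _ _ tx xx; have := phi_gt0 t; rewrite {1}/P; lra.
have : x * Phi t <= x * Phi (x - 1) by rewrite ler_nM2l// Phi_le_mono.
by have := phi_gt0 (x - 1); move: Pt P1; rewrite /P; lra.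
Qed.

(** The sign of the derivative is given by [mills_lt]. This strictness is what makes [w] unique. *)
Lemma phi_over_Phi_lt x y : x < y -> phi y / Phi y < phi x / Phi x.
Proof.
move=> xy; pose q z := phi z / Phi z.
pose dq z := phi z * (- Phi z ^- 2 * phi z) + (Phi z)^-1 * (- z * phi z).
rewrite -ltrN2; apply: (@derive_gt0_lt _ (fun z => - q z) (fun z => - dq z)) => //.
- move=> z _; have Pz0 : Phi z != 0 by rewrite gt_eqF ?Phi_gt0.
  exact: is_deriveN (is_derive_fun_mul (is_derive_phi z)
    (is_deriveV Pz0 (is_derive_Phi z))).
- move=> z _; have pz := phi_gt0 z; have Pz := Phi_gt0 z.
  have -> : - dq z = phi z * (phi z - - z * Phi z) / Phi z ^+ 2.
    by rewrite /dq; field; rewrite gt_eqF.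
  by rewrite divr_gt0 ?exprn_gt0// mulr_gt0// subr_gt0 mills_lt.
Qed.

(** * Growth of [phi ^+ 2] relative to [Phi] *)

Lemma phi_incr x y : x <= y -> y <= 0 -> phi x <= phi y.
Proof. by move=> xy y0; apply: ler_phi; rewrite !ler0_norm; lra. Qed.

(** As [phi c ^+ 2] is proportional to [exp (- c^2)], the solution is [c = sqrt (1 - ln 2)]. *)
Lemma phi_sqr_double : exists2 c : R, 0 <= c & phi c ^+ 2 = 2 * phi 1 ^+ 2 /\ 20 / 37 <= c.
Proof.
(* From [2 u <= 2 sinh u] at [u = ln 2 / 2], that is [ln 2 <= sqrt 2 / 2], with
   [sqrt 2 <= 99 / 70]. *)
have ln2 : ln 2 <= 99 / 140 :> R.
  have u0 : 0 <= ln 2 / 2 :> R by rewrite divr_ge0// ln_ge0//; lra.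
  have := sinh_ge u0; rewrite expRN.
  set r := expR (ln 2 / 2); have r0 : 0 < r by exact: expR_gt0.
  have r2 : r * r = 2.
    by rewrite -expRD -[RHS](@lnK R 2) ?posrE//; congr expR; field.
  have -> : r^-1 = r / 2 by rewrite -r2; field; rewrite gt_eqF.
  have : r <= 99 / 70.
    by rewrite leNgt; apply/negP => H; nra.
  lra.
exists (Num.sqrt (1 - ln 2)); first exact: sqrtr_ge0.
have ln2' : 0 <= 1 - ln 2 :> R by lra.
split; last first.
  have c0 : 0 <= 20 / 37 :> R by lra.
  rewrite -ler_sqr ?nnegrE ?sqrtr_ge0 ?c0// sqr_sqrtr//; lra.
rewrite !phiE sqr_sqrtr// !exprMn -!expRM_natl.
have -> : 2%:R * (- (1 - ln 2) / 2) = ln 2 + 2%:R * (- 1 ^+ 2 / 2) :> R by field.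
by rewrite expRD lnK ?posrE//; ring.
Qed.

(** It suffices that [Phi (- c) <= 2 * Phi (- 1)]. By the mean value theorem the increment from
    [- 1] to [- c] is at most [phi c * (1 - c)], hence at most [99/70 * 17/37 * phi 1], just below
    [65/100 * phi 1 <= Phi (- 1)]. *)
Lemma double_quantile :
  exists y, [/\ Phi y = 2 * Phi (- 1), y <= 0 & 2 * phi 1 ^+ 2 <= phi y ^+ 2].
Proof.
have half := Phi_N1_lt_half; have P1 := Phi_gt0 (- 1 : R).
have [y yE] : exists y, Phi y = 2 * Phi (- 1) by apply: Phi_onto; lra.
have y0 : y <= 0.
  rewrite -Phi_le_mono yE; have N10 : - 1 < 0 :> R by lra.
  have [c /andP[c1 c0] E] := mean_value N10 (fun t _ => is_derive_Phi t).
  by have := mills_lt (- 1 : R); have := phi_incr (ltW c1) (ltW c0); lra.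
exists y; split=> //; have [c c0 [phic cge]] := phi_sqr_double.
suff cy : - c <= y.
  rewrite -phic ler_sqr ?nnegrE ?(ltW (phi_gt0 _))//.
  by rewrite -(phiN c) phi_incr.
have p1 := phi_gt0 (1 : R); have pc := phi_gt0 c; have P1ge := Phi_N1_ge.
have phic_le : phi c <= 99 / 70 * phi 1.
  rewrite -ler_sqr ?nnegrE ?mulr_ge0 ?(ltW (phi_gt0 _))// phic exprMn.
  by rewrite ler_pM2r ?exprn_gt0//; lra.
rewrite leNgt; apply/negP => yc; have [c1|c1] := ltP c 1; last first.
  have : phi c <= phi 1 by apply: ler_phi; rewrite !ger0_norm.
  by clear - phic p1 pc; nra.
have N1c : - 1 < - c by clear - c1; lra.
have [d /andP[d1 dc] E] := mean_value N1c (fun t _ => is_derive_Phi t).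
have pdc : phi d <= phi c.
  by rewrite -(phiN c) phi_incr ?(ltW dc)// oppr_le0.
have pd := phi_gt0 d.
have : phi d * (- c - - 1) <= phi c * (17 / 37).
  by rewrite ler_pM ?(ltW pd)//; clear - c1 cge; lra.
by move: yc; rewrite -Phi_mono yE; clear - E phic_le P1ge p1; lra.
Qed.

(* As a function of [Phi x], [phi x ^+ 2] is convex for [x <= - 1] and concave
   for [- 1 <= x <= 0]. Hence above [- 1] only the right end [y] of the range
   matters, where [phi y ^+ 2 >= 2 * phi 1 ^+ 2] and [Phi y = 2 * Phi (- 1)]. *)
Lemma phi_sqr_ge x0 x : x0 <= - 1 -> phi x0 <= 2 * Phi x0 -> x0 <= x ->
  Phi x <= 2 * Phi x0 -> phi x0 ^+ 2 / Phi x0 * Phi x <= phi x ^+ 2.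
Proof.
move=> x01 q0 x0x Px.
have [y [yE y0 phiy]] := double_quantile.
set k := phi x0 ^+ 2 / Phi x0.
have k0 : 0 < k by rewrite divr_gt0 ?exprn_gt0 ?Phi_gt0 ?phi_gt0.
pose h z := phi z * phi z - k * Phi z.
pose p z := - z * phi z.
have dp z : is_derive z 1 p (- z * (- z * phi z) + phi z * - 1).
  exact: is_derive_fun_mul (is_deriveNid z 1) (is_derive_phi z).
have dh z : is_derive z 1 h (phi z * (p z + p z - k)).
  have := is_derive_fun_add (is_derive_fun_mul (is_derive_phi z) (is_derive_phi z))
    (is_deriveN (is_derive_fun_mul (is_derive_cst k z 1) (is_derive_Phi z))).
  by move=> H; apply: is_derive_eq H _; rewrite /p/=; ring.
have p_incr z z' : z <= z' -> z' <= - 1 -> p z <= p z'.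
  move=> zz' z'1; apply: derive_ge0_le zz' (fun t _ => dp t) _ => t tz.
  have -> : - t * (- t * phi t) + phi t * - 1 = phi t * ((1 - t) * (- 1 - t)).
    by ring.
  by rewrite mulr_ge0 ?mulr_ge0 ?(ltW (phi_gt0 _))//; lra.
have p_decr z z' : - 1 <= z -> z <= z' -> z' <= 0 -> p z' <= p z.
  move=> z1 zz' z'0; apply: derive_le0_ge zz' (fun t _ => dp t) _ => t tz.
  have -> : - t * (- t * phi t) + phi t * - 1 = - (phi t * ((1 - t) * (1 + t))).
    by ring.
  by rewrite oppr_le0 mulr_ge0 ?mulr_ge0 ?(ltW (phi_gt0 _))//; lra.
have h_x0 : h x0 = 0.
  by rewrite /h /k; field; rewrite gt_eqF ?Phi_gt0.
(* The slope of [h] in the variable [Phi] is [2 p - k]; at [x0] it is nonnegative because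
   [- 2 x0 * Phi x0 >= 2 * Phi x0 >= phi x0]. *)
have px0 : 0 <= p x0 + p x0 - k.
  have -> : p x0 + p x0 - k = phi x0 * (- 2 * x0 * Phi x0 - phi x0) / Phi x0.
    by rewrite /p /k; field; rewrite gt_eqF ?Phi_gt0.
  rewrite divr_ge0 ?mulr_ge0 ?(ltW (phi_gt0 _)) ?(ltW (Phi_gt0 _))//.
  by have := Phi_gt0 x0; nra.
have h_low z : x0 <= z -> z <= - 1 -> 0 <= h z.
  move=> x0z z1; rewrite -h_x0.
  apply: derive_ge0_le x0z (fun t _ => dh t) _ => t /andP[x0t tz].
  rewrite mulr_ge0 ?(ltW (phi_gt0 _))//.
  by have := @p_incr x0 t (ltW x0t); lra.
suff : 0 <= h x by rewrite subr_ge0 -expr2.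
have [x1|/ltW x1] := leP x (- 1); first exact: h_low.
have xy : x <= y.
  by rewrite -Phi_le_mono yE; move: x01; rewrite -Phi_le_mono; lra.
have hN1 := h_low _ x01 (lexx _).
have hy : 0 <= h y.
  by move: hN1 phiy; rewrite /h yE phiN; clear; lra.
(* Since [p] decreases on [[- 1, 0]], a nonnegative slope at [x] means [h] has grown since [- 1]; a
   negative one means it still falls until [y]. *)
have [pk|/ltW pk] := leP 0 (p x + p x - k).
  apply: le_trans hN1 _; apply: derive_ge0_le x1 (fun t _ => dh t) _ => t /andP[t1 tx].
  rewrite mulr_ge0 ?(ltW (phi_gt0 _))//.
  by have := @p_decr t x (ltW t1) (ltW tx) (le_trans xy y0); lra.
apply: le_trans hy _; apply: derive_le0_ge xy (fun t _ => dh t) _ => t /andP[tx ty].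
rewrite pmulr_rle0 ?phi_gt0//.
by have := @p_decr x t x1 (ltW tx); lra.
Qed.

End MillsRatio.

(** * Rescaling by [w], and the choice of the threshold [T] *)

Section ScaledProfile.
Context {R : realType}.
Implicit Types x y z w a b : R.
Local Notation phi := (@phi R).
Local Notation Phi := (@Phi R).
Local Notation T := (21 / 100 : R).

Let sT := Num.sqrt (T / 2).

Let sT_gt0 : 0 < sT. Proof. by rewrite sqrtr_gt0; lra. Qed.

Let sT_sqr : sT ^+ 2 = T / 2. Proof. by rewrite sqr_sqrtr//; lra. Qed.

(** Putting [T / w = Phi x0] turns [Iw w T = sT] into this equation. The sign change on [[- 2, - 1]]
    comes from [mills_lt] at [- 2] and [Phi_N1_ge] at [- 1]; the latter needs
    [T <= 65/100 * sqrt (T / 2)], that is [T <= 0.21125]. *)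
Lemma threshold_quantile : exists2 x0, x0 <= - 1 & T * phi x0 = sT * Phi x0.
Proof.
pose Q x := T * phi x - sT * Phi x.
have s2 : sT <= 2 * T.
  by rewrite -ler_sqr ?nnegrE ?sT_sqr ?(ltW sT_gt0)//; lra.
have s1 : T <= 65 / 100 * sT.
  by rewrite -ler_sqr ?nnegrE ?exprMn ?sT_sqr ?mulr_ge0 ?(ltW sT_gt0)//; lra.
have cQ : {within `[- 2, - 1], continuous Q}.
  apply: continuous_subspaceT => x.
  exact: derive_continuous (is_derive_fun_add
    (is_derive_fun_mul (is_derive_cst T x 1) (is_derive_phi x))
    (is_deriveN (is_derive_fun_mul (is_derive_cst sT x 1) (is_derive_Phi x)))).
have N21 : - 2 <= - 1 :> R by lra.
have Q2 : 0 <= Q (- 2).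
  by have := mills_lt (- 2 : R); have := Phi_gt0 (- 2 : R); rewrite /Q; nra.
have Q1 : Q (- 1) <= 0.
  by have := @Phi_N1_ge R; have := phi_gt0 (1 : R); rewrite /Q phiN; nra.
have [|x] := @IVT R Q (- 2) (- 1) 0 N21 cQ; first by rewrite ge_min le_max Q1 Q2 orbT.
by rewrite in_itv/= => /andP[_ x1] Qx; exists x => //; move: Qx; rewrite /Q; lra.
Qed.

Lemma Iw_threshold_inj v w : T <= v -> T <= w ->
  Iw v T = sT -> Iw w T = sT -> v = w.
Proof.
have quantile u : T <= u -> Iw u T = sT ->
    exists x, T / u = Phi x /\ phi x / Phi x = sT / T.
  move=> Tu; have u0 : 0 < u by lra.
  have Tu1 : T / u <= 1 by rewrite ler_pdivrMr// mul1r.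
  have Tu0 : 0 < T / u by rewrite divr_gt0//; lra.
  (* At [T / u = 1] the profile vanishes, whereas [sT > 0]. *)
  rewrite /Iw; have [Tu_lt|] := ltP (T / u) 1; last first.
    move=> Tu_ge; rewrite /iso_profile (ltNge _ 1) Tu_ge andbF mulr0 => s0.
    by move: sT_gt0; rewrite -s0 ltxx.
  have [|x xE] := @Phi_onto R (T / u); first by rewrite Tu0.
  rewrite -xE iso_profile_Phi => uphi; exists x; split=> //.
  by rewrite -uphi xE; field; rewrite gt_eqF.
move=> Tv Tw /(quantile _ Tv)[x [vx qx]] /(quantile _ Tw)[y [wy qy]].
have xy : x = y.
  have [|yx|//] := ltgtP x y => [xy|].
    by have := phi_over_Phi_lt xy; rewrite qx qy ltxx.
  by have := phi_over_Phi_lt yx; rewrite qx qy ltxx.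
apply/invr_inj/(@mulfI _ T); first by rewrite gt_eqF//; lra.
by rewrite vx wy xy.
Qed.

Context (x0 : R) (x0N1 : x0 <= - 1) (x0E : T * phi x0 = sT * Phi x0).

Let w := T / Phi x0.

Let w_gt0 : 0 < w. Proof. by rewrite divr_gt0 ?Phi_gt0//; lra. Qed.

Let Tw : T / w = Phi x0.
Proof. by rewrite /w; field; rewrite gt_eqF ?Phi_gt0. Qed.

Lemma threshold_le : T <= w.
Proof.
rewrite ler_pdivlMr ?Phi_gt0//.
by have := Phi_lt1 x0; lra.
Qed.

Lemma Iw_threshold : Iw w T = sT.
Proof.
rewrite /Iw Tw iso_profile_Phi /w mulrAC x0E.
by field; rewrite gt_eqF ?Phi_gt0.
Qed.

Lemma Iw_ge0 a : 0 <= Iw w a.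
Proof. by rewrite mulr_ge0 ?iso_profile_ge0// ltW. Qed.

Lemma Iw_two_point a b : 0 <= a -> 0 <= b -> (a + b) / 2 <= T ->
  ((a - b) / 2) ^+ 2 + ((Iw w a + Iw w b) / 2) ^+ 2 <= Iw w ((a + b) / 2) ^+ 2.
Proof.
move=> a0 b0 ab; have := @two_point _ (a / w) (b / w).
have -> : (a / w + b / w) / 2 = (a + b) / 2 / w by field; rewrite gt_eqF.
have wi : 0 < w^-1 by rewrite invr_gt0.
move=> H; have {}H := H (mulr_ge0 a0 (ltW wi)) (mulr_ge0 b0 (ltW wi)).
have {H} : (a / w - b / w) ^+ 2 + (iso_profile (a / w) + iso_profile (b / w)) ^+ 2 <=
    4 * iso_profile ((a + b) / 2 / w) ^+ 2.
  apply: H; apply: (@le_trans _ _ (T / w)); first by rewrite ler_pM2r.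
  by rewrite Tw Phi_le_mono.
rewrite /Iw; set i := iso_profile _; set j := iso_profile _; set k := iso_profile _.
have aE : a = w * (a / w) by field; rewrite gt_eqF.
have bE : b = w * (b / w) by field; rewrite gt_eqF.
set c := a / w in aE *; set d := b / w in bE * => H.
have -> : ((a - b) / 2) ^+ 2 + ((w * i + w * j) / 2) ^+ 2 =
    w ^+ 2 * (((c - d) ^+ 2 + (i + j) ^+ 2) / 4) by rewrite aE bE; field.
by rewrite [leRHS]exprMn ler_pM2l ?exprn_gt0//; lra.
Qed.

(** With [b = w * Phi x], dividing by [w ^+ 2] gives exactly [phi_sqr_ge]: the line [b / 2] meets
    [Iw w b ^+ 2] at [b = T]. *)
Lemma Iw_sqr_ge b : T <= b -> b <= 2 * T -> b / 2 <= Iw w b ^+ 2.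
Proof.
move=> Tb b2T; have half := @Phi_N1_lt_half R.
have bw0 : Phi x0 <= b / w by rewrite -Tw ler_pM2r ?invr_gt0.
have bw2 : b / w <= 2 * Phi x0 by rewrite -Tw mulrA ler_pM2r ?invr_gt0.
have P0 := Phi_gt0 x0; have P1 : Phi x0 <= Phi (- 1) by rewrite Phi_le_mono.
have [|x xE] := @Phi_onto R (b / w); first by lra.
rewrite /Iw -xE iso_profile_Phi; have bE : b = w * Phi x.
  by rewrite xE; field; rewrite gt_eqF.
have phi0 : phi x0 = sT * Phi x0 / T by rewrite -x0E; field.
have q0 : phi x0 <= 2 * Phi x0.
  rewrite phi0 -mulrA (mulrC (Phi x0)) mulrA ler_pM2r// ler_pdivrMr; last by lra.
  by rewrite -ler_sqr ?nnegrE ?sT_sqr ?(ltW sT_gt0)//; lra.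
have := @phi_sqr_ge _ x0 x x0N1 q0; rewrite -Phi_le_mono xE.
move=> /(_ bw0 bw2); rewrite -xE => H.
have -> : b / 2 = w ^+ 2 * (phi x0 ^+ 2 / Phi x0 * Phi x).
  rewrite phi0 !exprMn sT_sqr bE /w; field; by rewrite gt_eqF.
by rewrite [leRHS]exprMn ler_pM2l ?exprn_gt0.
Qed.

End ScaledProfile.

(** * Splitting the cube along a coordinate, and level-1 inequalities *)

Section Cube.
Context {R : realType}.

(** The position [i0] is arbitrary: the induction splits the first coordinate, the balanced case one
    with the largest coefficient. *)
Definition insert_bit n (i0 : 'I_n.+1) (b : bool) (x : cube n) : cube n.+1 :=
  [ffun i => if unlift i0 i is Some j then x j else b].

Lemma insert_bit_at n (i0 : 'I_n.+1) b x : insert_bit i0 b x i0 = b.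
Proof. by rewrite ffunE unlift_none. Qed.

Lemma insert_bit_lift n (i0 : 'I_n.+1) b x j :
  insert_bit i0 b x (lift i0 j) = x j.
Proof. by rewrite ffunE liftK. Qed.

Lemma insert_bit_bij n (i0 : 'I_n.+1) :
  bijective (fun p : bool * cube n => insert_bit i0 p.1 p.2).
Proof.
exists (fun y : cube n.+1 => (y i0, [ffun j => y (lift i0 j)] : cube n)) => [[b x]|y] /=.
  rewrite insert_bit_at; congr pair; apply/ffunP => j.
  by rewrite ffunE insert_bit_lift.
by apply/ffunP => i; rewrite ffunE; case: unliftP => [j ->|->//]; rewrite ffunE.
Qed.

Lemma card_cube n : #|{: cube n}| = (2 ^ n)%N.
Proof. by rewrite card_ffun card_bool card_ord. Qed.

Lemma expect_insert n (i0 : 'I_n.+1) (F : cube n.+1 -> R) :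
  expect F = (expect (F \o insert_bit i0 false) + expect (F \o insert_bit i0 true)) / 2.
Proof.
rewrite /expect !card_cube expnS natrM invfM mulrCA mulrC -mulrDl; congr (_ * _ * _).
rewrite (reindex (fun p : bool * cube n => insert_bit i0 p.1 p.2)) /=; last first.
  exact/onW_bij/insert_bit_bij.
rewrite -(pair_bigA _ (fun b x => F (insert_bit i0 b x)))/=.
by rewrite big_bool addrC.
Qed.

Lemma expectD n (F G : cube n -> R) :
  expect (fun x => F x + G x) = expect F + expect G.
Proof. by rewrite /expect big_split mulrDl. Qed.

Lemma expectN n (F : cube n -> R) : expect (fun x => - F x) = - expect F.
Proof. by rewrite /expect sumrN mulNr. Qed.

Lemma expectZ n c (F : cube n -> R) : expect (fun x => c * F x) = c * expect F.
Proof. by rewrite /expect -mulr_sumr mulrA. Qed.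

Lemma expect_cst n (c : R) : expect (fun _ : cube n => c) = c.
Proof.
have N0 : #|{: cube n}|%:R != 0 :> R by rewrite card_cube pnatr_eq0 expn_eq0.
by rewrite /expect sumr_const -[c *+ _]mulr_natr; exact: mulfK.
Qed.

Lemma eq_expect n (F G : cube n -> R) : F =1 G -> expect F = expect G.
Proof. by move=> FG; congr (_ / _); apply: eq_bigr => x _. Qed.

Lemma ler_expect n (F G : cube n -> R) :
  (forall x, F x <= G x) -> expect F <= expect G.
Proof. by move=> FG; rewrite ler_wpM2r ?invr_ge0// ler_sum. Qed.

Lemma expect_cube0 (F : cube 0 -> R) x : expect F = F x.
Proof.
have -> : F = fun=> F x by apply/funext => y; congr F; apply/ffunP => -[].
exact: expect_cst.
Qed.

Definition flip n (x : cube n) : cube n := [ffun i => ~~ x i].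

Lemma flipK n : involutive (@flip n).
Proof. by move=> x; apply/ffunP => i; rewrite !ffunE negbK. Qed.

Lemma expect_flip n (F : cube n -> R) : expect (F \o @flip n) = expect F.
Proof.
congr (_ / _); rewrite [RHS](reindex (@flip n))//.
exact/onW_bij/inv_bij/flipK.
Qed.

Lemma cube_coord_flip n (i : 'I_n) x : cube_coord i (flip x) = - cube_coord i x :> R.
Proof. by rewrite /cube_coord ffunE; case: (x i); rewrite ?opprK. Qed.

(** The analogue of [fhat] for real-valued functions, needed for the odd part of a boolean one. *)
Definition coef n (F : cube n -> R) i := expect (fun x => F x * cube_coord i x).

Lemma coef_at n (i0 : 'I_n.+1) (F : cube n.+1 -> R) :
  coef F i0 = (expect (F \o insert_bit i0 false) - expect (F \o insert_bit i0 true)) / 2.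
Proof.
rewrite /coef (expect_insert i0) -expectN; congr ((_ + _) / _); apply: eq_expect => x /=.
  by rewrite /cube_coord insert_bit_at mulr1.
by rewrite /cube_coord insert_bit_at mulrN1.
Qed.

Lemma coef_lift n (i0 : 'I_n.+1) (F : cube n.+1 -> R) j :
  coef F (lift i0 j) =
  (coef (F \o insert_bit i0 false) j + coef (F \o insert_bit i0 true) j) / 2.
Proof.
rewrite /coef (expect_insert i0); congr ((_ + _) / _); apply: eq_expect => x /=;
  by rewrite /cube_coord insert_bit_lift.
Qed.

(** Induction on the dimension: the squared mean and first coefficient add up to the average of the
    squared means of the halves; convexity of the square handles the other coefficients. *)
Lemma bessel_level1 n (F : cube n -> R) :
  expect F ^+ 2 + \sum_i coef F i ^+ 2 <= expect (fun x => F x ^+ 2).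
Proof.
elim: n F => [|n IHn] F.
  by rewrite !(expect_cube0 _ [ffun=> false]) big_ord0 addr0.
rewrite (bigD1_ord ord0)//= coef_at [X in X ^+ 2 + _](expect_insert ord0).
rewrite [leRHS](expect_insert ord0).
set F0 := F \o insert_bit ord0 false; set F1 := F \o insert_bit ord0 true.
have := IHn F0; have := IHn F1.
rewrite -[expect (_ \o insert_bit ord0 false)]/(expect (fun x => F0 x ^+ 2)).
rewrite -[expect (_ \o insert_bit ord0 true)]/(expect (fun x => F1 x ^+ 2)).
have : \sum_(i < n) coef F (lift ord0 i) ^+ 2 <=
    (\sum_i coef F0 i ^+ 2 + \sum_i coef F1 i ^+ 2) / 2.
  rewrite -big_split mulr_suml ler_sum// => i _ /=.
  rewrite coef_lift -/F0 -/F1; have := sqr_ge0 (coef F0 i - coef F1 i); nra.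
lra.
Qed.

(** The triangle inequality for the Euclidean norm, reduced to Cauchy-Schwarz. *)
Lemma sum_sqr_mean_le n (u v : 'I_n -> R) A B : 0 <= A -> 0 <= B ->
  \sum_i u i ^+ 2 <= A ^+ 2 -> \sum_i v i ^+ 2 <= B ^+ 2 ->
  \sum_i ((u i + v i) / 2) ^+ 2 <= ((A + B) / 2) ^+ 2.
Proof.
move=> A0 B0 uA vB.
suff uv : \sum_i u i * v i <= A * B.
  have -> : \sum_i ((u i + v i) / 2) ^+ 2 =
      (\sum_i u i ^+ 2 + \sum_i v i ^+ 2) / 4 + (\sum_i u i * v i) / 2.
    rewrite -big_split !mulr_suml -big_split; apply: eq_bigr => i _ /=.
    by field.
  by nra.
have zero (p q : 'I_n -> R) : \sum_i p i ^+ 2 <= 0 -> \sum_i p i * q i = 0.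
  move=> p0; apply: big1 => i _.
  have : p i ^+ 2 = 0.
    apply/eqP; rewrite eq_le sqr_ge0 andbT; apply: le_trans p0.
    by rewrite (bigD1 i)//= lerDl sumr_ge0// => j _; exact: sqr_ge0.
  by move/eqP; rewrite sqrf_eq0 => /eqP ->; rewrite mul0r.
have [A_gt0|A_le0] := ltP 0 A; last first.
  have AE : A = 0 by lra.
  by rewrite AE expr0n/= in uA *; rewrite zero// mul0r.
have [B_gt0|B_le0] := ltP 0 B; last first.
  have BE : B = 0 by lra.
  under eq_bigr do rewrite mulrC.
  by rewrite BE expr0n/= in vB *; rewrite zero// mulr0.
(* Weighted arithmetic-geometric mean inequality; the weights make each sum contribute at most
   [A * B]. *)
have : \sum_i u i * v i <=
    (B / A * \sum_i u i ^+ 2 + A / B * \sum_i v i ^+ 2) / 2.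
  rewrite !mulr_sumr -big_split mulr_suml ler_sum// => i _ /=.
  have : 0 <= (B * u i - A * v i) ^+ 2 / (A * B) / 2.
    by rewrite !divr_ge0 ?sqr_ge0// mulr_ge0 // ltW.
  suff -> : (B * u i - A * v i) ^+ 2 / (A * B) / 2 =
    (B / A * u i ^+ 2 + A / B * v i ^+ 2) / 2 - u i * v i by lra.
  by field; rewrite !gt_eqF.
move=> /le_trans; apply.
have : B / A * \sum_i u i ^+ 2 <= B / A * A ^+ 2.
  by rewrite ler_wpM2l// divr_ge0.
have : A / B * \sum_i v i ^+ 2 <= A / B * B ^+ 2.
  by rewrite ler_wpM2l// divr_ge0.
have -> : A / B * B ^+ 2 = A * B by field; rewrite gt_eqF.
have -> : B / A * A ^+ 2 = A * B by field; rewrite gt_eqF.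
lra.
Qed.

(** * Restrictions of boolean functions and the induction on the dimension *)

Definition fix_bit n (i0 : 'I_n.+1) b (f : boolfun n.+1) : boolfun n :=
  [ffun x => f (insert_bit i0 b x)].

Lemma expect_fix_bit n (i0 : 'I_n.+1) b (f : boolfun n.+1) :
  expect ((fun x => (f x)%:R : R) \o insert_bit i0 b) = mean (fix_bit i0 b f).
Proof. by apply: eq_expect => x; rewrite /= ffunE. Qed.

Lemma mean_split n (i0 : 'I_n.+1) (f : boolfun n.+1) :
  mean f = (mean (fix_bit i0 false f) + mean (fix_bit i0 true f)) / 2 :> R.
Proof. by rewrite /mean (expect_insert i0) !expect_fix_bit. Qed.

Lemma fhat_split_at n (i0 : 'I_n.+1) (f : boolfun n.+1) :
  fhat f i0 = (mean (fix_bit i0 false f) - mean (fix_bit i0 true f)) / 2 :> R.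
Proof.
rewrite -!expect_fix_bit; exact: (coef_at i0 (fun x => (f x)%:R)).
Qed.

Lemma fhat_split_lift n (i0 : 'I_n.+1) (f : boolfun n.+1) j :
  fhat f (lift i0 j) =
  (fhat (fix_bit i0 false f) j + fhat (fix_bit i0 true f) j) / 2 :> R.
Proof.
apply: etrans (coef_lift i0 (fun x => (f x)%:R) j) _; congr ((_ + _) / _);
  by apply: eq_expect => x; rewrite /= ffunE.
Qed.

Lemma weight1_split n (i0 : 'I_n.+1) (f : boolfun n.+1) : weight1 f =
  ((mean (fix_bit i0 false f) - mean (fix_bit i0 true f)) / 2) ^+ 2 +
  \sum_j ((fhat (fix_bit i0 false f) j + fhat (fix_bit i0 true f) j) / 2) ^+ 2
  :> R.
Proof.
rewrite /weight1 (bigD1_ord i0)//= fhat_split_at; congr (_ + _).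
by apply: eq_bigr => j _; rewrite fhat_split_lift.
Qed.

Lemma mean_ge0 n (f : boolfun n) : 0 <= mean f :> R.
Proof.
rewrite -[leLHS](expect_cst n 0); apply: ler_expect => x; exact: ler0n.
Qed.

Lemma weight1_ge0 n (f : boolfun n) : 0 <= weight1 f :> R.
Proof. by apply: sumr_ge0 => i _; exact: sqr_ge0. Qed.

(* The odd part of [f] has the level-1 coefficients of [f], and its square is
   at most [(f x + f (- x)) / 4]. *)
Lemma weight1_le_half_mean n (f : boolfun n) : weight1 f <= mean f / 2 :> R.
Proof.
pose F x : R := (f x)%:R; pose G x := 1 / 2 * (F x + - F (flip x)).
have GE i : coef G i = fhat f i.
  have -> : coef G i = 1 / 2 * (fhat f i +
      expect ((fun x => F x * cube_coord i x) \o @flip n)).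
    rewrite -expectD -expectZ; apply: eq_expect => x /=.
    by rewrite cube_coord_flip /G; ring.
  by rewrite expect_flip -/(fhat f i); field.
have -> : mean f / 2 = expect (fun x => 1 / 4 * (F x + (F \o @flip n) x)).
  by rewrite expectZ expectD expect_flip -/(mean f); field.
have := bessel_level1 G; under eq_bigr do rewrite GE.
have : expect (fun x => G x ^+ 2) <= expect (fun x => 1 / 4 * (F x + (F \o @flip n) x)).
  by apply: ler_expect => x; rewrite /G /F/=; case: (f x); case: (f (flip x)) => /=; lra.
by have := sqr_ge0 (expect G); rewrite -/(weight1 f); lra.
Qed.

Lemma weight1_two_point (T : R) (J : R -> R) :
  (forall a, 0 <= J a) ->
  (forall a, T <= a -> a <= 2 * T -> a / 2 <= J a ^+ 2) ->
  (forall a b, 0 <= a -> 0 <= b -> (a + b) / 2 <= T ->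
    ((a - b) / 2) ^+ 2 + ((J a + J b) / 2) ^+ 2 <= J ((a + b) / 2) ^+ 2) ->
  forall n (f : boolfun n), mean f <= T -> weight1 f <= J (mean f) ^+ 2.
Proof.
move=> J0 J_large J_two_point; elim=> [|n IHn] f fT.
  by rewrite /weight1 big_ord0 sqr_ge0.
rewrite (weight1_split ord0); rewrite (mean_split ord0) in fT *.
set f0 := fix_bit _ _ _ in fT *; set f1 := fix_bit _ true _ in fT *.
(* Both means are nonnegative with sum at most [2 * T], so each half falls under the induction
   hypothesis or the Bessel bound. *)
have half (g : boolfun n) : mean g <= 2 * T -> weight1 g <= J (mean g) ^+ 2.
  have [/IHn//|/ltW Tg g2T] := leP (mean g) T.
  exact: le_trans (weight1_le_half_mean g) (J_large _ Tg g2T).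
have m0 := mean_ge0 f0; have m1 := mean_ge0 f1.
apply: le_trans (J_two_point _ _ m0 m1 fT); rewrite lerD2l.
by apply: sum_sqr_mean_le => //; apply: half; lra.
Qed.

(** * Complements and balanced functions *)

Definition negb_fun n (f : boolfun n) : boolfun n := [ffun x => ~~ f x].

Lemma mean_negb n (f : boolfun n) : mean (negb_fun f) = 1 - mean f :> R.
Proof.
rewrite -(expect_cst n 1) -expectN -expectD; apply: eq_expect => x.
by rewrite ffunE; case: (f x); rewrite ?subrr ?subr0.
Qed.

Lemma expect_cube_coord n (i : 'I_n) : expect (cube_coord i) = 0 :> R.
Proof.
have := expect_flip (cube_coord i).
have -> : cube_coord i \o @flip n = fun x => - cube_coord i x :> R.
  by apply/funext => x /=; rewrite cube_coord_flip.
by rewrite expectN; lra.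
Qed.

Lemma fhat_negb n (f : boolfun n) i : fhat (negb_fun f) i = - fhat f i :> R.
Proof.
rewrite -[RHS]add0r -(expect_cube_coord i).
rewrite -expectN -expectD; apply: eq_expect => x.
by rewrite ffunE; case: (f x) => /=; ring.
Qed.

Lemma weight1_negb n (f : boolfun n) : weight1 (negb_fun f) = weight1 f :> R.
Proof. by apply: eq_bigr => i _; rewrite fhat_negb sqrrN. Qed.

(** The halves have means [1 / 2 + beta] and [1 / 2 - beta]; complementing the larger one preserves
    its weight. Both weights are then at most [C], and the triangle inequality applies with
    [A = B = sqrt C]. *)
Lemma weight1_balanced n (f : boolfun n.+1) (i0 : 'I_n.+1) (beta C : R) :
  mean f = 1 / 2 :> R -> `|fhat f i0| = beta ->
  (forall g : boolfun n, mean g = 1 / 2 - beta -> weight1 g <= C) ->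
  weight1 f <= beta ^+ 2 + C.
Proof.
move=> f_half f_beta HC; rewrite (weight1_split i0) -fhat_split_at.
rewrite -[fhat f i0 ^+ 2]real_normK ?num_real// f_beta lerD2l.
have C_bound b : weight1 (fix_bit i0 b f) <= C :> R.
  move: f_half f_beta; rewrite (mean_split i0) fhat_split_at.
  set p := mean (fix_bit i0 false f); set q := mean (fix_bit i0 true f).
  have [pq0|pq0] := leP 0 ((p - q) / 2) => pq1 pq2.
    rewrite ger0_norm// in pq2; case: b; last rewrite -weight1_negb; apply: HC.
      by rewrite -/q; lra.
    by rewrite mean_negb -/p; lra.
  rewrite ltr0_norm// in pq2; case: b; first rewrite -weight1_negb; apply: HC.
    by rewrite mean_negb -/q; lra.
  by rewrite -/p; lra.
have C0 : 0 <= C := le_trans (weight1_ge0 _) (C_bound true).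
have := @sum_sqr_mean_le _ (fhat (fix_bit i0 false f)) (fhat (fix_bit i0 true f)).
move=> /(_ (Num.sqrt C) (Num.sqrt C) (sqrtr_ge0 _) (sqrtr_ge0 _)).
have -> : (Num.sqrt C + Num.sqrt C) / 2 = Num.sqrt C by field.
rewrite sqr_sqrtr//.
by apply; exact: C_bound.
Qed.

Lemma max_fhat_attained n (f : boolfun n.+1) :
  exists i, `|fhat f i| = max_fhat f :> R.
Proof.
have [|i _ E] := @eq_bigmax _ _ _ 0 (ord0 : 'I_n.+1) xpredT
  (fun i => `|fhat f i| : R) isT; first by move=> i _; exact: normr_ge0.
by exists i; rewrite -E.
Qed.

Lemma W_balanced_le (beta C : R) :
  (forall n (g : boolfun n), mean g = 1 / 2 - beta -> weight1 g <= C) ->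
  (W (1 / 2) beta <= (beta ^+ 2 + C)%:E)%E.
Proof.
(* Dimension 0 is ruled out, so there is a coordinate to split; the base value of the maximum is
   minus infinity. *)
move=> HC; apply: ge_ereal_sup => _ [[//|n] _ <-].
apply: (big_ind (fun x => (x <= (beta ^+ 2 + C)%:E)%E)) => [|x y xC yC|f].
- exact: leNye.
- by rewrite ge_max xC yC.
- move=> /andP[/eqP fm /eqP fb]; rewrite lee_fin.
  have [i ib] := max_fhat_attained f; rewrite fb in ib.
  by apply: weight1_balanced fm ib _ => g; exact: HC.
Qed.

End Cube.

Theorem theorem6 (R : realType) :
  let T : R := 21 / 100 in
  exists w : R,
    unique (fun v : R => T <= v /\ Iw v T = Num.sqrt (T / 2)) w /\
    forall beta : R, dyadic beta -> 0 <= beta -> beta <= 1 / 2 ->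
      (W (1 / 2) beta <= (beta ^+ 2 + chi T w (1 / 2 - beta))%:E)%E.
Proof.
move=> T; have [x0 x0N1 x0E] := @threshold_quantile R.
(* This choice makes [x0] the quantile of [T / w]. *)
exists (T / Phi x0); split.
  split; first by split; [exact: threshold_le|exact: Iw_threshold].
  move=> v [Tv IvT].
  exact: Iw_threshold_inj (threshold_le x0) Tv (Iw_threshold x0E) IvT.
move=> beta _ _ _; apply: W_balanced_le => n g gE.
rewrite -gE /chi; case: ifP => [gT|_]; last exact: weight1_le_half_mean.
apply: (weight1_two_point (Iw_ge0 x0) _ _ gT).
- by move=> a; exact: Iw_sqr_ge.
- by move=> a b; exact: Iw_two_point.
Qed.
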